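(* Let $n$ be a finite natural number and, for each $i\le n$ (i.e. $i=0,1,\dots,n$), let $X_i$ be a compact separable LOTS. Then $\prod_{i\le n}X_i$ is $(2^n+1)$-dissipated. Furthermore, if all the $X_i$ are not scattered, and at most one of the $X_i$ is second countable, then $\prod_{i\le n}X_i$ is not $2^n$-dissipated.
   Context: All spaces are Hausdorff; $f:X\to Y$ always denotes a continuous map. A LOTS is a totally ordered set with the order topology. A subset of a space is perfect iff it is closed, non-empty and has no isolated points; a space is scattered iff it has no perfect subsets. Let $X,Y$ be compact and $f:X\to Y$. A loose family for $f$ is a disjoint family $\mathcal P$ of closed subsets of $X$ such that for some non-scattered $Q\subseteq Y$, $Q=f(P)$ for all $P\in\mathcal P$. For a cardinal $\kappa$, $f$ is $\kappa$-tight iff there is no loose family for $f$ of size $\kappa$. For compact $X,Y,Z$, $f:X\to Y$ and $g:X\to Z$, $f$ is finer than $g$ iff there is a continuous $\Gamma:f(X)\to g(X)$ with $g=\Gamma\circ f$. $X$ is $\kappa$-dissipated iff $X$ is compact and whenever $g:X\to Z$ with $Z$ compact metrizable, there is a $\kappa$-tight $f:X\to Y$, for some compact metrizable $Y$, that is finer than $g$. *)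

(* Defs.v *)
From HB Require Import structures.
From mathcomp Require Import all_boot all_order all_algebra.
From mathcomp Require Import all_classical all_reals all_analysis.

Set Implicit Arguments.
Unset Strict Implicit.
Unset Printing Implicit Defensive.

Import Order.TTheory GRing.Theory Num.Theory.

Local Open Scope classical_set_scope.
Local Open Scope ring_scope.
Local Open Scope card_scope.

Definition separable (T : topologicalType) :=
  exists2 D : set T, countable D & dense D.

(* The axioms of [dist] are those of the factory [isMetric]. *)
Definition metrizable (R : realType) (T : topologicalType) :=
  exists dist : T -> T -> R,
    [/\ forall x, dist x x = 0,
        forall x y, dist x y = 0 -> x = y,
        forall x y, dist x y = dist y x,
        forall y x z, dist x z <= dist x y + dist y z &
        forall x, nbhs x =
          filter_from [set e : R | 0 < e] (fun e => [set y | dist x y < e])].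

(* Unlike the library's [perfect_set], a perfect subset is non-empty. *)
Definition perfect_subset (T : topologicalType) (A : set T) :=
  [/\ closed A, A !=set0 & isolated A = set0].

Definition scattered (T : topologicalType) :=
  forall A : set T, ~ perfect_subset A.

(* [Q] is coerced to the type [set_type Q], with the subspace topology. *)
Definition loose_family (X Y : topologicalType) (f : X -> Y)
    (P : set (set X)) :=
  [/\ trivIset P id,
      forall A, P A -> closed A &
      exists2 Q : set Y, ~ scattered Q & forall A, P A -> f @` A = Q].

(* A cardinal is given by any set [kappa] of that cardinality; the finite
   cardinal k is `I_k. *)
Definition tight (U : Type) (kappa : set U) (X Y : topologicalType)
    (f : X -> Y) :=
  ~ exists2 P : set (set X), loose_family f P & P #= kappa.

Definition to_range (X Y : Type) (f : X -> Y) (x : X) : range f :=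
  exist _ (f x) (mem_set (imageT f x)).

Definition finer (X Y Z : topologicalType) (f : X -> Y) (g : X -> Z) :=
  exists2 Gamma : range f -> range g,
    continuous Gamma & forall x, g x = set_val (Gamma (to_range f x)).

Definition dissipated (R : realType) (U : Type) (kappa : set U)
    (X : topologicalType) :=
  compact [set: X] /\
  forall (Z : topologicalType) (g : X -> Z),
    compact [set: Z] -> metrizable R Z -> continuous g ->
    exists (Y : topologicalType) (f : X -> Y),
      [/\ compact [set: Y], metrizable R Y, continuous f,
          tight kappa f & finer f g].

(* Main.v *)
Require Import Defs.
From HB Require Import structures.
From mathcomp Require Import all_boot all_order all_algebra.
From mathcomp Require Import all_classical all_reals all_analysis.
From mathcomp Require Import lra.

(** A continuous map [g] from a product of compact LOTS to a metrizable space
  only sees countably many cuts in each coordinate: it identifies points which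
  no cut of suitable countable sets [E i] separates.  In a separable compact
  LOTS, countably many monotone maps to [0, 1] isolate the points of [E i]
  (taken dense), hence have fibers with at most two points; together they give
  a map [f] to a compact metrizable space which is finer than [g].  A loose
  family for [f] has at most [2 ^ n] members because, over a non-isolated
  point, one of the [n + 1] coordinates is forced to one of its two possible
  values.

  Conversely, if [X i] is not second countable then some jump of [X i] avoids
  any given countable set, so no map to a metrizable space distinguishes its
  two endpoints.  Fixing all coordinates but [m] at endpoints of such jumps
  gives [2 ^ n] disjoint copies of [X m] with the same image, and that image is
  not scattered as soon as [f] is finer than a map with two-point fibers on
  [X m]. *)

Set Implicit Arguments.
Unset Strict Implicit.
Unset Printing Implicit Defensive.

Import Order.TTheory GRing.Theory Num.Theory.
Import numFieldNormedType.Exports.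

Local Open Scope classical_set_scope.

(** * Topologies given by a distance function *)

Section metric_type.
Context (R : realType) (T : choiceType) (dist : T -> T -> R).
Local Open Scope ring_scope.
Hypothesis distxx : forall x, dist x x = 0.
Hypothesis dist0 : forall x y, dist x y = 0 -> x = y.
Hypothesis distC : forall x y, dist x y = dist y x.
Hypothesis distD : forall y x z, dist x z <= dist x y + dist y z.

(** The dummy [let] makes the type depend on the metric axioms, so that the metric structure can be
    attached to it. *)
Definition metric_type : Type := let _ := (distxx, dist0, distC, distD) in T.

HB.instance Definition _ := Choice.on metric_type.
HB.instance Definition _ :=
  isMetric.Build R metric_type distxx dist0 distC distD.

Lemma nbhs_metric_type (x : metric_type) : nbhs x =
  filter_from [set e : R | 0 < e] (fun e => [set y | dist x y < e]).
Proof.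
apply/funext => U; apply/propext; split.
  by move=> /nbhs_ballP [e e0 eU]; exists e.
by move=> [e e0 eU]; apply/nbhs_ballP; exists e.
Qed.

Lemma metrizable_metric_type : metrizable R metric_type.
Proof. by exists dist; split => // x; exact: nbhs_metric_type. Qed.

End metric_type.

Lemma metrizable_hausdorff (R : realType) (Y : topologicalType) :
  metrizable R Y -> hausdorff_space Y.
Proof.
move=> [dist [d0 d1 dC dD dn]] p q pq; apply: d1; apply/eqP.
have dge x y : (0 <= dist x y)%R.
  by have := dD y x x; rewrite d0 (dC y x) -mulr2n pmulrn_lge0.
rewrite eq_le dge andbT leNgt; apply/negP => d_gt0.
have e0 : (0 < dist p q / 2)%R by rewrite divr_gt0.
have [||z [/= pz qz]] :=
  pq [set y | dist p y < dist p q / 2]%R [set y | dist q y < dist p q / 2]%R.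
- by rewrite dn; exists (dist p q / 2)%R.
- by rewrite dn; exists (dist p q / 2)%R.
have := dD z p q; rewrite leNgt (dC z q) => /negP; apply.
by rewrite [ltRHS]splitr ltrD.
Qed.

(** * Compact metrizable quotients defined by countably many real functions *)

Section real_valued_family.
Context (R : realType) (X : topologicalType) (J : countType) (c : J -> X -> R).
Local Open Scope ring_scope.
Hypothesis cX : compact [set: X].
Hypothesis c_cont : forall j, continuous (c j).
Hypothesis c01 : forall j x, 0 <= c j x <= 1.

Let ev (x : X) : J -> R := c^~ x.

Let Y : choiceType := set_type (range ev).

(** These weights tend to 0 along the enumeration of [J], so the weighted supremum distance induces
    the product topology on the range of [ev]. *)
Let wt (j : J) : R := (pickle j).+1%:R^-1.

Let diffs (u v : Y) := [set wt j * `|val u j - val v j| | j in [set: J]].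

(* [0] keeps the set nonempty, as [has_sup] requires, when [J] is empty. *)
Let dist (u v : Y) : R := sup (0 |` diffs u v).

Let val01 (u : Y) j : 0 <= val u j <= 1.
Proof. by case: u => u /= /set_mem [x _ <-]; exact: c01. Qed.

Let wt_ge0 j : 0 <= wt j. Proof. by rewrite invr_ge0. Qed.

Let diff_le (u v : Y) j : wt j * `|val u j - val v j| <= wt j.
Proof.
rewrite ler_piMr//; have := val01 u j; have := val01 v j.
move=> /andP[? ?] /andP[? ?]; rewrite ler_norml; apply/andP; split; lra.
Qed.

Let dist_ubound (u v : Y) : ubound (0 |` diffs u v) 1.
Proof.
move=> _ [->|[j _ <-]]; first exact: ler01.
by rewrite (le_trans (diff_le _ _ _))// invf_le1// ler1n.
Qed.

Let dist_has_sup (u v : Y) : has_sup (0 |` diffs u v).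
Proof. by split; [exists 0; left|exists 1; exact: dist_ubound]. Qed.

Let diff_dist (u v : Y) j : wt j * `|val u j - val v j| <= dist u v.
Proof. by apply: sup_ubound; [case: (dist_has_sup u v)|right; exists j]. Qed.

Let dist_ge0 u v : 0 <= dist u v.
Proof. by apply: sup_ubound; [case: (dist_has_sup u v)|left]. Qed.

Let dist_le (u v : Y) (e : R) : 0 <= e ->
  (forall j, wt j * `|val u j - val v j| <= e) -> dist u v <= e.
Proof.
move=> e0 H; apply: ge_sup; first by exists 0; left.
by move=> _ [->|[j _ <-]].
Qed.

Let distxx u : dist u u = 0.
Proof.
apply/eqP; rewrite eq_le dist_ge0 andbT dist_le// => j.
by rewrite subrr normr0 mulr0.
Qed.

Let dist0 u v : dist u v = 0 -> u = v.
Proof.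
move=> uv; apply: val_inj; apply/funext => j; apply/eqP.
rewrite -subr_eq0 -normr_le0 -(@pmulr_rle0 _ (wt j)) ?invr_gt0// -uv.
exact: diff_dist.
Qed.

Let distC u v : dist u v = dist v u.
Proof.
by apply/eqP; rewrite eq_le !dist_le// => j; rewrite distrC diff_dist.
Qed.

Let distD v u w : dist u w <= dist u v + dist v w.
Proof.
apply: dist_le => [|j]; first exact: addr_ge0.
rewrite (le_trans _ (lerD (diff_dist _ _ j) (diff_dist _ _ j)))//.
by rewrite -mulrDr ler_wpM2l// ler_distD.
Qed.

Lemma compact_metrizable_quotient :
  exists (Y : topologicalType) (f : X -> Y),
    [/\ compact [set: Y], metrizable R Y, continuous f &
        forall x y, f x = f y <-> forall j, c j x = c j y].
Proof.
pose M : topologicalType := metric_type distxx dist0 distC distD.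
pose f : X -> M := to_range ev.
have cf : continuous f.
  move=> x U; rewrite nbhs_metric_type => -[e /= e0 eU].
  have e20 : 0 < e / 2 by rewrite divr_gt0.
  (* Indices coded by at least [N] have weight below [e / 2], so continuity is needed only for the
     finitely many others. *)
  have [N _ HN] := near_infty_natSinv_lt (PosNum e20).
  have : \forall y \near x, forall j, wt j * `|c j x - c j y| <= e / 2.
    have : \forall y \near x, forall k : 'I_N,
       forall j, unpickle k = Some j -> wt j * `|c j x - c j y| <= e / 2.
      apply: filter_forall => k; case: (unpickle k) => [j|]; last first.
        by apply: nearW => y j.
      have /cvgrPdist_lt /(_ _ e20) := @c_cont j x.
      apply: filterS => y cxy _ [<-]; rewrite (le_trans _ (ltW cxy))//.
      by rewrite ler_piMl// invf_le1// ler1n.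
    apply: filterS => y H j; have [jN|Nj] := ltnP (pickle j) N.
      by apply: (H (Ordinal jN)); rewrite pickleK.
    by rewrite (le_trans (diff_le (f x) (f y) j))// ltW//; exact: HN.
  apply: filterS => y H; apply: eU => /=.
  rewrite (le_lt_trans (@dist_le (f x) (f y) _ (ltW e20) H))//.
  by rewrite gtr_pMr// invf_lt1// ltr1n.
exists M, f; split.
- have -> : [set: M] = f @` [set: X].
    apply/seteqP; split => // -[u /= uX] _; have [x _ xu] := set_mem uX.
    by exists x => //; apply: val_inj.
  by apply: continuous_compact => //; exact: continuous_subspaceT.
- exact: metrizable_metric_type.
- exact: cf.
- move=> x y; split=> [/(congr1 val) /= fxy j|H].
    by have := congr1 (@^~ j) fxy.
  by apply: val_inj; apply/funext => j /=; exact: H.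
Qed.

End real_valued_family.

(** * Compactness, boxes in products, and the finer relation *)

Lemma compact_finite_subcover (X : topologicalType) (U : X -> set X) :
  compact [set: X] -> (forall x, nbhs x (U x)) ->
  exists2 A, finite_set A & forall x, exists2 y, A y & U y x.
Proof.
move=> /compact_near_coveringP cX nU.
(* Eventually along [F] means for all sets containing some fixed finite set. *)
pose F : set_system (set X) :=
  filter_from finite_set (fun A => [set B | A `<=` B]).
have FF : Filter F.
  apply: filter_from_filter; first by exists set0.
  move=> A B fA fB; exists (A `|` B); first by rewrite finite_setU.
  by move=> C /= ABC; split=> x ?; apply: ABC; [left|right].
have [|A fA FA] := cX _ F (fun A x => exists2 y, A y & U y x) FF.
  move=> x _; exists (U x, [set A | A x]) => /=.
    by split => //; exists [set x] => //= B; exact.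
  by move=> [z A] [/= Uz Ax]; exists x.
by exists A => // x; apply: FA.
Qed.

Lemma nbhs_prod_box (I : finType) (K : I -> topologicalType)
    (x : prod_topology K) (W : set (prod_topology K)) :
  nbhs x W <-> exists2 V : forall i, set (K i),
    (forall i, nbhs (x i) (V i)) & (forall y, (forall i, V i (y i)) -> W y).
Proof.
split=> [nW|[V nV VW]]; last first.
  have : \forall y \near x, forall i, V i (y i).
    apply: (@filter_forall _ _
      (fun i => [set y : prod_topology K | V i (y i)]) (nbhs x) _) => i.
    exact: (@proj_continuous I K i x (V i) (nV i)).
  by move=> H; apply: filterS H => y; exact: VW.
pose F := filter_from [set V : forall i, set (K i) | forall i, nbhs (x i) (V i)]
  (fun V => [set y : prod_topology K | forall i, V i (y i)]).
have FF : Filter F.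
  apply: filter_from_filter; first by exists (fun=> setT) => i; exact: filterT.
  move=> V V' nV nV'; exists (fun i => V i `&` V' i).
    by move=> i; exact: filterI.
  by move=> y VV'y; split=> i; case: (VV'y i).
have Fx : F --> x.
  apply/cvg_sup => i U [_ [[B oB <-]] Bx BU].
  (* This box is [B] in coordinate [i] and the whole space elsewhere, where no proof [e] exists;
     [ecast] transports [z] into [K i]. *)
  exists (fun j => [set z | forall e : j = i, B (ecast k (K k) e z)]).
    move=> j; have [ji|nij] := eqVneq j i.
      rewrite {}ji nbhsE; exists B => // z Bz e.
      by rewrite (eq_irrelevance e (erefl _)).
    by apply: filterS filterT => z _ e; rewrite e eqxx in nij.
  by move=> y Hy; apply: BU; exact: (Hy i erefl).
by have [V nV VW] := Fx _ nW; exists V.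
Qed.

Lemma compact_prod_topology (I : eqType) (K : I -> topologicalType) :
  (forall i, compact [set: K i]) -> compact [set: prod_topology K].
Proof.
by move=> cK; have := tychonoff cK; congr compact; apply/seteqP; split.
Qed.

Lemma to_range_continuous (X Y : topologicalType) (f : X -> Y) :
  continuous f -> continuous (to_range f).
Proof.
move=> cf x U [_ [[B oB <-]] Bx BU].
have fB : \forall y \near x, B (f y) by apply: cf; exact: open_nbhs_nbhs.
by apply: (@filterS _ (nbhs x)) fB => y By; exact: BU.
Qed.

(** A continuous map from a compact space to a Hausdorff one is closed, and the preimage of a closed
    set under the induced map [G] is the [f]-image of a closed set. *)
Lemma compact_finer (X Y Z : topologicalType) (f : X -> Y) (g : X -> Z) :
  compact [set: X] -> hausdorff_space Y -> continuous f -> continuous g ->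
  (forall x y, f x = f y -> g x = g y) -> finer f g.
Proof.
move=> cX hY cf cg fg.
have ex (y : range f) : exists x, f x = val y.
  by case: y => y /= yf; have [x _ <-] := set_mem yf; exists x.
pose h y := projT1 (cid (ex y)).
have fh y : f (h y) = val y by rewrite /h; case: cid.
pose G (y : range f) : range g := to_range g (h y).
exists G; last by move=> x; apply: fg; rewrite fh.
apply/continuous_closedP => C clC.
have clgC : closed (to_range g @^-1` C).
  apply: preimage_closed => // x _; exact: to_range_continuous.
have -> : G @^-1` C = set_val @^-1` (f @` (to_range g @^-1` C)).
  apply/seteqP; split=> [y Cy|y [x Cx fxy]]; first by exists (h y).
  suff Gy : G y = to_range g x by rewrite /preimage/= Gy.
  by apply: val_inj => /=; apply: fg; rewrite fh.
apply: preimage_closed.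
  by move=> x _; exact: (@initial_continuous (set_type (range f)) Y set_val x).
apply: compact_closed => //; apply: continuous_compact.
  exact: continuous_subspaceT.
exact: subclosed_compact clgC cX _.
Qed.

(** * Cuts of linear orders and continuous maps on products *)

Section order_stable.
Local Open Scope order_scope.

(** Not symmetric: an [s] equal to [x] puts no condition on [y]. *)
Definition same_side d (T : orderType d) (S : set T) (x y : T) :=
  forall s, S s -> (s < x -> s < y) /\ (x < s -> y < s).

Lemma same_sideW d (T : orderType d) (S S' : set T) x y :
  S `<=` S' -> same_side S' x y -> same_side S x y.
Proof. by move=> SS' xy s /SS'; exact: xy. Qed.

(** An open interval can be left only by reaching or crossing one of its at most two endpoints,
    which form [S]. *)
Lemma nbhs_same_side d (T : orderTopologicalType d) (x : T) (U : set T) :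
  nbhs x U -> exists S V, [/\ finite_set S, nbhs x V, V `<=` U &
    forall y y', V y -> same_side S y y' -> V y'].
Proof.
rewrite {1}itv_nbhsE => -[i [oi xi] iU].
exists [set s | i.1 = BRight s \/ i.2 = BLeft s], [set` i]; split => //.
- apply: (@sub_finite_set _ _ ((fun b => if b is BSide _ s then s else x) @`
    [set i.1; i.2])); last exact/finite_image/finite_set2.
  by move=> s /= [is1|is2]; [exists i.1 => //; [left|rewrite is1]|
    exists i.2 => //; [right|rewrite is2]].
- by rewrite itv_nbhsE; exists i.
- case: i oi {iU xi} => -[[]a|[]] [[]b|[]] //= _ y y';
    rewrite /= !in_itv /= ?andbT.
  + move=> /andP[ay yb] H; apply/andP; split.
      by apply: (H a _).1 => //; left.
    by apply: (H b _).2 => //; right.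
  + by move=> ay H; apply: (H a _).1 => //; left.
  + by move=> yb H; apply: (H b _).2 => //; right.
Qed.

Lemma itv_convex d (T : orderType d) (i : interval T) x y t :
  x \in i -> y \in i -> x <= t -> t <= y -> t \in i.
Proof.
case: i => l r; rewrite !itv_boundlr => /andP[ix _] /andP[_ yi] xt ty.
apply/andP; split.
  by apply: le_trans ix _; rewrite bnd_simp.
by apply: le_trans yi; rewrite bnd_simp.
Qed.

End order_stable.

(** For each [k], finitely many open boxes cover the product, with [g] within [1 / (k + 1)] of its
    value at the centre on each. [E] collects the endpoints of their sides: points separated by no
    such endpoint share a box for every [k]. *)
Lemma countable_cuts (R : realType) (I : finType) (d : I -> Order.disp_t)
    (X : forall i, orderTopologicalType (d i)) (Z : topologicalType)
    (g : prod_topology X -> Z) :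
  (forall i, compact [set: X i]) -> metrizable R Z -> continuous g ->
  exists2 E : forall i, set (X i), forall i, countable (E i) &
    forall x y, (forall i, same_side (E i) (x i) (y i)) -> g x = g y.
Proof.
move=> cX [dist [d0 d1 dC dD dn]] cg.
have cP := compact_prod_topology cX.
have SV (kx : nat * prod_topology X) :
    exists SV : (forall i, set (X i)) * (forall i, set (X i)),
    [/\ forall i, finite_set (SV.1 i), forall i, nbhs (kx.2 i) (SV.2 i),
        forall i y y', SV.2 i y -> same_side (SV.1 i) y y' -> SV.2 i y' &
        forall y : prod_topology X, (forall i, SV.2 i (y i)) ->
          (dist (g kx.2) (g y) < kx.1.+1%:R^-1)%R].
  case: kx => k x /=.
  have : nbhs x (g @^-1` [set z | dist (g x) z < k.+1%:R^-1]%R).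
    by apply: cg; rewrite dn; exists (k.+1%:R^-1)%R => //=; rewrite invr_gt0.
  move=> /nbhs_prod_box [V nV VW].
  have [S HS] := all_sig (fun i => cid (nbhs_same_side (nV i))).
  have [V' HV'] := all_sig (fun i => cid (HS i)).
  exists (S, V') => /=; split=> [i|i|i|y Hy].
  - by case: (HV' i).
  - by case: (HV' i).
  - by case: (HV' i).
  - by apply: VW => i; case: (HV' i) => _ _ sub _; exact: sub.
have [F HF] := choice SV.
have cov k : exists A : set (prod_topology X), finite_set A /\
    forall x, exists2 z, A z & forall i, (F (k, z)).2 i (x i).
  have [|A fA HA] := compact_finite_subcover
      (U := fun z => [set x | forall i, (F (k, z)).2 i (x i)]) cP.
    move=> x; apply/nbhs_prod_box; exists (F (k, x)).2 => //.
    by case: (HF (k, x)).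
  by exists A.
have [A HA] := choice cov.
exists (fun i => \bigcup_k \bigcup_(z in A k) (F (k, z)).1 i) => [i|x y xy].
  apply: bigcup_countable => // k _; apply: bigcup_countable.
    exact/finite_set_countable/(HA k).1.
  by move=> z _; apply: finite_set_countable; case: (HF (k, z)).
have dge a b : (0 <= dist a b)%R.
  by have := dD b a a; rewrite d0 (dC b a) -mulr2n pmulrn_lge0.
apply/d1/eqP; rewrite eq_le dge andbT; apply/ler_addgt0Pl => /= e e0.
have e20 : (0 < e / 2)%R by rewrite divr_gt0.
have [k _ /(_ k (leqnn k)) /= ke] := near_infty_natSinv_lt (PosNum e20).
have [z Az Fzx] := (HA k).2 x.
have Fzy i : (F (k, z)).2 i (y i).
  case: (HF (k, z)) => _ _ /(_ i (x i) (y i) (Fzx i)) + _; apply.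
  by apply: same_sideW (xy i) => s Fs; exists k => //; exists z.
case: (HF (k, z)) => _ _ _ close; rewrite addr0.
rewrite (le_trans (dD (g z) _ _))// (dC (g x)) [leRHS]splitr.
by rewrite lerD// (le_trans (ltW (close _ _)))// ltW.
Qed.

(** * Monotone Urysohn functions *)

Section monotone_maps.
Context (R : realType) d (T : orderTopologicalType d).
Hypothesis cT : compact [set: T].

Lemma monotone_urysohn (a b : T) : (a < b)%O -> exists h : T -> R,
  [/\ continuous h, {homo h : x y / (x <= y)%O >-> (x <= y)%R},
      forall x, (0 <= h x <= 1)%R, h a = 0%R & h b = 1%R].
Proof.
move=> ab; have nT := compact_normal order_hausdorff cT.
have [|u [cu u01 ua ub]] := (@uniform_separatorP T R `]-oo, a] `[b, +oo[).1.
  apply: normal_uniform_separator => //.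
  rewrite -subset0 => x [] /=; rewrite !in_itv /= andbT => xa bx.
  by have := lt_le_trans ab bx; rewrite ltNge xa.
have {}u01 x : (0 <= u x <= 1)%R.
  by have := u01 (u x) (imageT u x); rewrite /= in_itv.
(* The running supremum of a continuous function is monotone and continuous. *)
pose h x := sup (u @` [set t | (t <= x)%O]).
have hs x : has_sup (u @` [set t | (t <= x)%O]).
  split; first by exists (u x), x => /=.
  by exists 1%R => _ [t _ <-]; case/andP: (u01 t).
have uh t x : (t <= x)%O -> (u t <= h x)%R.
  by move=> tx; apply: sup_ubound; [case: (hs x)|exists t].
have hle x (m : R) : (forall t, (t <= x)%O -> u t <= m)%R -> (h x <= m)%R.
  move=> H; apply: ge_sup; first by case: (hs x).
  by move=> _ [t tx <-]; exact: H.
have hh : {homo h : x y / (x <= y)%O >-> (x <= y)%R}.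
  by move=> x y xy; apply: hle => t tx; apply: uh; exact: le_trans xy.
have h01 x : (0 <= h x <= 1)%R.
  apply/andP; split; last by apply: hle => t _; case/andP: (u01 t).
  by apply: (le_trans _ (uh x x (lexx x))); case/andP: (u01 x).
exists h; split => //.
- move=> x; apply/cvgrPdist_le => e e0.
  have e20 : (0 < e / 2)%R by rewrite divr_gt0.
  have nu : nbhs x [set y | `|u x - u y| < e / 2]%R.
    by have /cvgrPdist_lt := cu x; exact.
  (* An order-convex neighbourhood contains all points between [x] and [y]; these are the only ones
     by which the two suprema differ, so [h] changes by at most [e]. *)
  move: nu; rewrite itv_nbhsE => -[i [oi xi] iu].
  have : nbhs x [set` i] by rewrite itv_nbhsE; exists i.
  apply: filterS => y /= yi.
  have ule t : t \in i -> (u t <= u x + e / 2)%R /\ (u x <= u t + e / 2)%R.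
    move=> /iu /=; rewrite ltr_norml => /andP[? ?]; split; lra.
  have [xy|/ltW yx] := leP x y.
    rewrite ler0_norm ?subr_le0 ?hh// opprB lerBlDr; apply: hle => t ty.
    have [tx|/ltW xt] := leP t x.
      by rewrite (le_trans (uh _ _ tx))// lerDr ltW.
    have [+ _] := ule t (itv_convex xi yi xt ty).
    have := uh _ _ (lexx x); lra.
  rewrite ger0_norm ?subr_ge0 ?hh// lerBlDr; apply: hle => t tx.
  have [ty|/ltW yt] := leP t y.
    by rewrite (le_trans (uh _ _ ty))// lerDr ltW.
  have [+ _] := ule t (itv_convex yi xi yt tx).
  have [_] := ule y yi.
  have := uh _ _ (lexx y); lra.
- apply/eqP; rewrite eq_le; case/andP: (h01 a) => -> _; rewrite andbT.
  by apply: hle => t ta; rewrite (ua (u t))//; exists t.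
- apply/eqP; rewrite eq_le; case/andP: (h01 b) => _ -> /=.
  by rewrite -(ub (u b)) ?uh//; exists b; rewrite //= in_itv /= lexx.
Qed.
End monotone_maps.

(** * Countable sets and jumps *)

Lemma countable_subsingleton (U : Type) (A : set U) :
  (forall x y, A x -> A y -> x = y) -> countable A.
Proof.
move=> A1; have [->|/set0P [x Ax]] := eqVneq A set0; first exact: countable0.
rewrite (_ : A = [set x]); first exact: countable1.
by apply/seteqP; split=> [y Ay|_ ->//]; exact: A1.
Qed.

Lemma countable_image (U V : Type) (f : U -> V) (A : set U) :
  countable A -> countable (f @` A).
Proof. exact: sub_countable (card_image_le f A). Qed.

Lemma countable_setU (U : Type) (A B : set U) :
  countable A -> countable B -> countable (A `|` B).
Proof.
move=> cA cB; rewrite -bigcup2E.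
by apply: bigcup_countable => // -[|[|n]] _ //=.
Qed.

(** The default [u0] is the value at numbers coding no element of [A], which may be empty. *)
Lemma countable_enum (U : Type) (u0 : U) (A : set U) : countable A ->
  exists2 c : nat -> U, A `<=` range c & forall k, A (c k) \/ c k = u0.
Proof.
move=> /countable_injP [f finj].
pose c k := xget (u0 : {classic U}) [set u | A u /\ f u = k].
exists c => [u Au|k]; last first.
  by rewrite /c; case: xgetP => [u -> [Au _]|_]; [left|right].
exists (f u) => //; rewrite /c; case: xgetP => [v _ [Av fv]|/(_ u)]; last first.
  by case.
by apply: finj => //; exact/mem_set.
Qed.

Section jumps.
Local Open Scope order_scope.
Local Open Scope classical_set_scope.
Context d (T : orderTopologicalType d).
Implicit Types (x y : T) (D E : set T).

Definition jump x y := x < y /\ forall z, ~ x < z < y.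

Definition jump_closure E : set T :=
  E `|` ((\bigcup_(e in E) [set x | jump x e]) `|`
         (\bigcup_(e in E) [set x | jump e x])).

(** Each point has at most one immediate predecessor and one immediate successor. *)
Lemma countable_jump_closure E : countable E -> countable (jump_closure E).
Proof.
move=> cE; apply: countable_setU => //.
apply: countable_setU; apply: bigcup_countable => // e Ee;
    apply: countable_subsingleton => x y [xe nx] [ye ny].
- have [xy|yx|//] := ltgtP x y; first by case: (nx y); rewrite xy.
  by case: (ny x); rewrite yx.
- have [xy|yx|//] := ltgtP x y; first by case: (ny x); rewrite xe.
  by case: (nx y); rewrite ye.
Qed.

Lemma dense_between D x y : dense D -> x < y -> ~ jump x y ->
  exists2 z, D z & x < z < y.
Proof.
move=> dD xy nj; have [|z []] := dD `]x, y[%classic _ (@itv_open _ _ x y).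
  apply/set0P/negP => /eqP e0; apply: nj; split => // z xzy.
  by have : `]x, y[%classic z; [rewrite /= in_itv|rewrite e0].
by rewrite /= in_itv => xzy Dz; exists z.
Qed.

(* Otherwise the open intervals with endpoints in a countable set would form a
   basis. *)
Lemma exists_jump E : separable T -> ~ @second_countable T -> countable E ->
  exists x y, [/\ jump x y, ~ E x & ~ E y].
Proof.
move=> [D cD dD] nsc cE; apply: contrapT => nj; apply: nsc.
have {nj} jE x y : jump x y -> jump_closure E x /\ jump_closure E y.
  move=> jxy; have [Ex|nEx] := pselect (E x).
    by split; [left|right; right; exists x].
  have [Ey|nEy] := pselect (E y); last by case: nj; exists x, y.
  by split; [right; left; exists y|left].
pose F := D `|` jump_closure E.
have cF : countable F.
  by apply: countable_setU => //; exact: countable_jump_closure.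
pose L : set (itv_bound T) := -oo%O |` ((fun a => BRight a) @` F).
pose U : set (itv_bound T) := +oo%O |` ((fun a => BLeft a) @` F).
exists ((fun lu => [set` Interval lu.1 lu.2]) @` (L `*` U)).
  apply: countable_image; apply: countableX; apply: countable_setU;
    by [exact: countable1|exact: countable_image].
split=> [_ [[l u] [Ll Uu] <-]|x W].
  apply: itv_open_ends_open.
  by case: Ll => [->|[a _ <-]]; case: Uu => [->|[b _ <-]].
rewrite itv_nbhsE => -[[l u] [oi xi] iW].
have [l' [Ll' ll' l'x]] : exists l', [/\ L l', l <= l' & l' <= BLeft x].
  move: xi; rewrite itv_boundlr => /andP[lx _].
  case: l oi lx {iW} => [b a|b] oi lx; last first.
    by exists -oo%O; rewrite (itv_open_ends_linfty oi); split => //; left.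
  have ba := itv_open_ends_lside oi; subst b.
  (* If [a] and [x] form a jump, [a] already lies in [F]; otherwise [D] provides an endpoint
     strictly between them. *)
  rewrite bnd_simp in lx; have [jax|nj] := pselect (jump a x).
    exists (BRight a); split; rewrite ?bnd_simp//.
    by right; exists a => //; right; case: (jE _ _ jax).
  have [z Dz /andP[az zx]] := dense_between dD lx nj.
  exists (BRight z); rewrite !bnd_simp; split => //; last exact: ltW.
  by right; exists z => //; left.
have [u' [Uu' uu' u'x]] : exists u', [/\ U u', u' <= u & BRight x <= u'].
  move: xi; rewrite itv_boundlr => /andP[_ xu].
  case: u oi xu {iW} => [b a|b] oi xu; last first.
    by exists +oo%O; rewrite (itv_open_ends_rinfty oi); split => //; left.
  have ba := itv_open_ends_rside oi; subst b.
  rewrite bnd_simp in xu; have [jxa|nj] := pselect (jump x a).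
    exists (BLeft a); split; rewrite ?bnd_simp//.
    by right; exists a => //; right; case: (jE _ _ jxa).
  have [z Dz /andP[xz za]] := dense_between dD xu nj.
  exists (BLeft z); rewrite !bnd_simp; split => //; last exact: ltW.
  by right; exists z => //; left.
exists [set` Interval l' u'].
  split; first by exists (l', u').
  by rewrite /= itv_boundlr l'x.
apply: subset_trans iW => y /=; rewrite !itv_boundlr => /andP[ly yu].
by rewrite (le_trans ll' ly) (le_trans yu).
Qed.

End jumps.

(** * Isolating the points of a countable set by monotone functions *)

Section monotone_separation.
Context (R : realType) d (T : orderTopologicalType d).

(** One Urysohn function for each pair [a < b] of the countable set [F] suffices. Such a pair lies
    between [e] and any other point [x]: it is [e] and [x] themselves if they form a jump, and
    otherwise [e] and a point of [D]. *)
Lemma monotone_separating (E : set T) :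
  compact [set: T] -> separable T -> countable E ->
  exists h : nat -> T -> R,
  [/\ forall k, continuous (h k),
      forall k, {homo h k : x y / (x <= y)%O >-> (x <= y)%R},
      forall k x, (0 <= h k x <= 1)%R &
      forall e x, E e -> h^~ x = h^~ e -> x = e].
Proof.
move=> cT [D cD dD] cE.
pose F := D `|` jump_closure E.
have cF : countable F.
  by apply: countable_setU => //; exact: countable_jump_closure.
have hex (p : T * T) : exists h : T -> R,
    [/\ continuous h, {homo h : x y / (x <= y)%O >-> (x <= y)%R},
    forall x, (0 <= h x <= 1)%R & (p.1 < p.2)%O -> h p.1 = 0%R /\ h p.2 = 1%R].
  have [pp|npp] := boolP (p.1 < p.2)%O.
    by have [h [? ? ? ? ?]] := monotone_urysohn R cT pp; exists h.
  exists (fun=> 0%R); split => //; first by move=> ?; exact: cvg_cst.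
  by move=> x; rewrite lexx ler01.
have [h Hh] := choice hex.
have [c Fc Hc] := countable_enum (cst 0%R)
  (countable_image h (countableX cF cF)).
have {}Hc k : [/\ continuous (c k),
    {homo c k : x y / (x <= y)%O >-> (x <= y)%R} &
    forall x, (0 <= c k x <= 1)%R].
  case: (Hc k) => [[p _ <-]|->]; first by case: (Hh p).
  by split=> // [?|?]; [exact: cvg_cst|rewrite lexx ler01].
have sep x a b y : c^~ x = c^~ y -> (x <= a)%O -> (a < b)%O -> (b <= y)%O ->
    F a -> F b -> False.
  move=> cxy xa ab bly Fa Fb.
  have FF : (F `*` F) (a, b) by [].
  have [k _ ck] := Fc (h (a, b)) (imageP h FF).
  have [_ hmon h01 /(_ ab) /= [ha hb]] := Hh (a, b).
  have := congr1 (@^~ k) cxy; rewrite /= ck => hxy.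
  by have := hmon _ _ xa; have := hmon _ _ bly; rewrite hxy ha hb; lra.
exists c; split=> [k|k|k|e x Ee cxe]; try by case: (Hc k).
have Fe : F e by right; left.
have [xe|ex|//] := ltgtP x e.
  have [j|nj] := pselect (jump x e).
    by case: (sep x x e e) => //; right; right; left; exists e.
  have [z Dz /andP[xz ze]] := dense_between dD xe nj.
  by case: (sep x z e e) => //; [exact: ltW|left].
have [j|nj] := pselect (jump e x).
  by case: (sep e e x x) => //; right; right; right; exists e.
have [z Dz /andP[ez zx]] := dense_between dD ex nj.
by case: (sep e e z x) => //; [exact: ltW|left].
Qed.

Lemma monotone_fiber_convex (h : nat -> T -> R) (x y z : T) :
  (forall k, {homo h k : x y / (x <= y)%O >-> (x <= y)%R}) ->
  (x <= y)%O -> (y <= z)%O -> h^~ x = h^~ z -> h^~ y = h^~ x.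
Proof.
move=> hh xy yz hxz; apply/funext => k; apply/eqP.
by rewrite eq_le {1}(congr1 (@^~ k) hxz) /= !hh.
Qed.

(** The interval from [x] to [z] contains [y], so it meets the dense set [E]. By convexity the point
    of [E] found there would share its fiber with [x], whereas points of [E] are alone in theirs. *)
Lemma monotone_fiber_le2 (E : set T) (h : nat -> T -> R) (x y z : T) :
  (forall k, {homo h k : x y / (x <= y)%O >-> (x <= y)%R}) ->
  dense E -> (forall e x, E e -> h^~ x = h^~ e -> x = e) ->
  (x < y)%O -> (y < z)%O -> h^~ x <> h^~ z.
Proof.
move=> hh dE hE xy yz hxz.
have [|e Ee /andP[xe ez]] := dense_between dE (lt_trans xy yz).
  by move=> [_ /(_ y)]; rewrite xy yz; exact.
have he := monotone_fiber_convex hh (ltW xe) (ltW ez) hxz.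
by have xE := hE _ _ Ee (esym he); rewrite xE ltxx in xe.
Qed.

End monotone_separation.

(** * Tightness of maps with two-point fibers in each coordinate *)

Lemma card_eq_finType (T : finType) : ([set: T] #= `I_#|T|)%card.
Proof.
apply: (card_eq_trans _ (card_esym card_II)).
have <- : enum_rank @` [set: T] = [set: 'I_#|T|].
  by apply/seteqP; split=> // i _; exists (enum_val i) => //; exact: enum_valK.
by apply/card_esym/inj_card_eq => x y _ _; exact: enum_rank_inj.
Qed.

Lemma not_scattered_limit (Y : topologicalType) (Q : set Y) :
  ~ scattered Q -> exists2 q, Q q &
    forall W, nbhs q W -> exists y, [/\ Q y, y <> q & W y].
Proof.
move=> /existsNP [A /contrapT [clA [a Aa] iA]]; exists (val a).
  by case: a {Aa} => a /= /set_mem.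
move=> W nW; apply: contrapT => nex.
have : isolated A a; last by rewrite iA.
split; first exact/mem_set.
exists (set_val @^-1` W).
  exact: (@initial_continuous (set_type Q) Y set_val a W nW).
apply/seteqP; split=> [y [Wy Ay]|_ ->]; last first.
  by split => //; exact: (nbhs_singleton nW).
apply: contrapT => ya; apply: nex; exists (val y); split => //.
  by case: y {Wy Ay ya} => y /= /set_mem.
by move=> /val_inj.
Qed.

Section tightness.
Context (n : nat) (d : 'I_n.+1 -> Order.disp_t).
Context (X : forall i, orderTopologicalType (d i)) (Y : topologicalType).
Context (f : prod_topology X -> Y).
Context (V : 'I_n.+1 -> Type) (p : forall i, X i -> V i).
Hypothesis cX : compact [set: prod_topology X].
Hypothesis hY : hausdorff_space Y.
Hypothesis cf : continuous f.
Hypothesis fE : forall x y, f x = f y <-> forall i, p (x i) = p (y i).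
Hypothesis p_convex : forall i (x y z : X i),
  (x <= y)%O -> (y <= z)%O -> p x = p z -> p y = p x.
Hypothesis p_le2 : forall i (x y z : X i), (x < y)%O -> (y < z)%O -> p x <> p z.

(** Since a class of [p] has at most two points, this bit and the class determine the point. *)
Let nonmin i (x : X i) := exists2 u, (u < x)%O & p u = p x.

Let nonmin_inj i (x y : X i) : p x = p y -> (nonmin x <-> nonmin y) -> x = y.
Proof.
move=> pxy nxy; have [xy|yx|//] := ltgtP x y.
  have [|u ux pu] := nxy.2; first by exists x.
  by case: (p_le2 ux xy); rewrite pu.
have [|u uy pu] := nxy.1; first by exists y.
by case: (p_le2 uy yx); rewrite pu.
Qed.

(** Leaving out the class of [x0 i] makes membership depend only on [f x], so that a side can be
    transferred between members of a loose family. *)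
Let side (x0 : prod_topology X) (b : bool) i := [set x : prod_topology X |
  p (x i) <> p (x0 i) /\ if b then (x i < x0 i)%O else (x0 i < x i)%O].

Let side_saturated x0 b i x y : f x = f y -> side x0 b i x -> side x0 b i y.
Proof.
move=> /fE /(_ i) pxy [px sx]; split; first by rewrite -pxy.
case: b sx => sx; rewrite ltNge; apply/negP => h; apply: px.
  by rewrite (p_convex (ltW sx) h pxy).
by rewrite pxy (p_convex h (ltW sx) (esym pxy)).
Qed.

(** Otherwise the open ray above [u] would contain the coordinate of a point of the side; lying
    between [u] and [x0 i], it would be in their common class by convexity. *)
Let closure_side_true x0 i x u : closure (side x0 true i) x ->
  p (x i) = p (x0 i) -> (u < x i)%O -> p u <> p (x i).
Proof.
move=> clx pxx0 ux pu.
have nu : nbhs x (proj i @^-1` `]u, +oo[).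
  apply: (@proj_continuous _ X i x); apply: open_nbhs_nbhs.
  by split; [exact: rray_open|rewrite /= in_itv /= andbT].
have [z [[pz zx0] /=]] := clx _ nu; rewrite in_itv /= andbT => uz.
by apply: pz; rewrite (p_convex (ltW uz) (ltW zx0)) -?pxx0.
Qed.

Let closure_side_false x0 i x u : closure (side x0 false i) x ->
  p (x i) = p (x0 i) -> (x i < u)%O -> p u <> p (x i).
Proof.
move=> clx pxx0 xu pu.
have nu : nbhs x (proj i @^-1` `]-oo, u[).
  apply: (@proj_continuous _ X i x); apply: open_nbhs_nbhs.
  by split; [exact: lray_open|rewrite /= in_itv].
have [z [[pz zx0] /=]] := clx _ nu; rewrite in_itv /= => zu.
by apply: pz; rewrite (p_convex (ltW zx0) (ltW zu)) // pu pxx0.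
Qed.

(* A non-isolated point [q] of [Q] is a limit of points of [Q] lying strictly on
   one side of it in some coordinate [i]. So every member of a loose family
   contains a point over [q] whose [i]-th coordinate is the extreme one of its
   class on that side, and only [2 ^ n] points are available. *)
Lemma tight_two_point_fibers : tight `I_(2 ^ n + 1) f.
Proof.
move=> [P [tP clP [Q nsQ fP]] cardP].
have [q Qq qlim] := not_scattered_limit nsQ.
have [A0 PA0] : P !=set0.
  apply/set0P/negP => /eqP P0; move: cardP; rewrite P0 card_eq_sym card_eq0.
  by move=> /eqP I0; have : `I_(2 ^ n + 1) 0%N; [rewrite /= addn1|rewrite I0].
have [x0 Ax0 fx0] : (f @` A0) q by rewrite fP.
have [[b i] bi] : exists bi : bool * 'I_n.+1,
    forall W, nbhs q W -> exists x, [/\ Q (f x), W (f x) & side x0 bi.1 bi.2 x].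
  (* If each of the finitely many sides missed a neighbourhood of [q], a point [y] of [Q] in all of
     these, distinct from [q], would have a preimage in [A0] on no side of [x0]; that preimage would
     be equivalent to [x0], giving [y = q]. *)
  apply: contrapT => /forallNP nbi.
  have exW bi : exists W, nbhs q W /\
      forall x, Q (f x) -> W (f x) -> ~ side x0 bi.1 bi.2 x.
    apply: contrapT => nW; apply: (nbi bi) => W nbW; apply: contrapT => nx.
    apply: nW; exists W; split => // x ? ? ?; apply: nx.
    by exists x.
  have [W HW] := choice exW.
  have : \forall y \near q, forall bi, W bi y.
    by apply: filter_forall => bi; case: (HW bi).
  move=> /qlim [y [Qy yq Wy]]; have [x A0x fxy] : (f @` A0) y by rewrite fP.
  have nside bi : ~ side x0 bi.1 bi.2 x by apply: (HW bi).2; rewrite fxy.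
  apply: yq; rewrite -fxy -fx0; apply/fE => i; apply: contrapT => px.
  have [xx0|x0x|xx0] := ltgtP (x i) (x0 i).
  - by case: (nside (true, i)).
  - by case: (nside (false, i)).
  - by apply: px; rewrite xx0.
have pt_ex A : exists x, P A -> [/\ A x, f x = q & closure (side x0 b i) x].
  have [PA|nPA] := pselect (P A); last by exists x0.
  (* The image of the compact set [closure S] is closed, and [q] adheres to it because [A] also maps
     onto [Q] and the side is saturated. *)
  pose S := A `&` side x0 b i.
  have : closed (f @` closure S).
    apply: compact_closed => //; apply: continuous_compact.
      exact: continuous_subspaceT.
    exact: subclosed_compact (@closed_closure _ S) cX _.
  move=> /(_ q) [|x Sx fx].
    move=> W nW; have [x [Qx Wx sx]] := bi W nW.
    have [a Aa fa] : (f @` A) (f x) by rewrite fP.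
    exists (f x); split => //; exists a => //.
    apply: subset_closure; split => //.
    exact: side_saturated (esym fa) sx.
  exists x => _; split => //.
    by apply: (clP _ PA); apply: closureS Sx => ? [].
  by apply: closureS Sx => ? [].
have [pt ptP] := choice pt_ex.
(* One bit for each coordinate other than [i]; coordinate [i] is forced by the closure condition. *)
pose sg (A : set (prod_topology X)) : {ffun 'I_n -> bool} :=
  [ffun k => `[< nonmin (pt A (lift i k)) >]].
have sg_inj : {in P &, injective sg}.
  move=> A B /set_mem PA /set_mem PB /ffunP sAB.
  have [Ax fA cA] := ptP A PA; have [Bx fB cB] := ptP B PB.
  have pAB j : p (pt A j) = p (pt B j) by move: j; apply/fE; rewrite fA fB.
  have pA : p (pt A i) = p (x0 i) by move: (i); apply/fE; rewrite fA fx0.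
  have pB : p (pt B i) = p (x0 i) by rewrite -pAB.
  suff ptAB : pt A = pt B.
    by apply: tP => //; exists (pt A); split => //; rewrite ptAB.
  apply: functional_extensionality_dep => j.
  case: (unliftP i j) => [k ->|->].
    apply: nonmin_inj => //; have := sAB k; rewrite !ffunE => e.
    by split=> H; apply/asboolP; [rewrite -e|rewrite e]; exact/asboolP.
  (* Both coordinates are the least point of the class of [x0 i] if [b] holds, and the greatest one
     otherwise. *)
  have [AB|BA|//] := ltgtP (pt A i) (pt B i).
    case: b cA cB {bi ptP pt_ex sg sAB} => cA cB.
      by case: (closure_side_true cB pB AB).
    by case: (closure_side_false cA pA AB).
  case: b cA cB {bi ptP pt_ex sg sAB} => cA cB.
    by case: (closure_side_true cA pA BA).
  by case: (closure_side_false cB pB BA).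
have : (`I_(2 ^ n + 1) #<= `I_(2 ^ n))%card.
  rewrite -(card_le_eql cardP) -(card_le_eql (inj_card_eq sg_inj)).
  apply: card_le_trans (card_leT _) _.
  have := card_eq_finType {ffun 'I_n -> bool}.
  by rewrite card_ffun card_bool card_ord card_eq_le => /andP[].
by rewrite card_le_II addn1 ltnn.
Qed.

End tightness.

(** * Perfect sets, images and subspaces *)

Lemma isolated_image (T Y : topologicalType) (k : T -> Y) (A : set T) :
  accessible_space T -> continuous k ->
  (forall x y z, k x = k y -> k y = k z -> [\/ x = y, y = z | x = z]) ->
  isolated A = set0 -> isolated (k @` A) = set0.
Proof.
move=> aT ck k2 iA; rewrite -subset0 => _ [/set_mem [a Aa <-] [W nW WA]].
have kN x : (k @^-1` W `&` A) x -> k x = k a.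
  move=> [Wx Ax]; have : (W `&` k @` A) (k x) by split => //; exists x.
  by rewrite WA.
have nN : nbhs a (k @^-1` W) by exact: ck.
suff [V nV VA] : exists2 V, nbhs a V & V `&` A = [set a].
  by have : isolated A a; [split; [exact/mem_set|exists V]|rewrite iA].
(* Besides [a], at most one point [b] of [A] is left in this neighbourhood; removing it isolates [a]
   in [A]. *)
have [[b [Nb ba]]|nb] := pselect (exists b, (k @^-1` W `&` A) b /\ b <> a).
  exists (k @^-1` W `&` ~` [set b]).
    apply: filterI => //; apply: open_nbhs_nbhs; split=> [|/esym //].
    by rewrite openC; exact: accessible_closed_set1.
  apply/seteqP; split=> [x [[Wx xb] Ax]|_ ->]; last first.
    by split => //; split; [exact: nbhs_singleton|move=> /esym].
  have kx : k x = k a by exact: kN.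
  by case: (k2 x a b kx (esym (kN _ Nb))) => // /esym.
exists (k @^-1` W) => //; apply/seteqP; split=> [x Nx|_ ->]; last first.
  by split => //; exact: nbhs_singleton.
by apply: contrapT => xa; apply: nb; exists x.
Qed.

Lemma perfect_not_scattered (Y : topologicalType) (Q B : set Y) :
  perfect_subset B -> B `<=` Q -> ~ scattered Q.
Proof.
move=> [clB [b Bb] iB] BQ /(_ (set_val @^-1` B)); apply; split.
- apply: preimage_closed => // x _.
  exact: (@initial_continuous (set_type Q) Y set_val x).
- by exists (exist _ b (mem_set (BQ _ Bb))).
- rewrite -subset0 => c [/set_mem Bc [V [_ [[W oW <-]] Wc WV] VB]].
  have : isolated B (val c); last by rewrite iB.
  split; first exact/mem_set.
  exists W; first exact: open_nbhs_nbhs.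
  apply/seteqP; split=> [y [Wy By]|_ ->//].
  pose y' : Q := exist _ y (mem_set (BQ _ By)).
  have : [set c] y' by rewrite -VB; split => //; exact: WV.
  by move=> /(congr1 val).
Qed.

(** * The two bounds for products of separable compact LOTS *)

Section dissipated_product.
Context (R : realType) (n : nat) (d : 'I_n.+1 -> Order.disp_t).
Context (X : forall i, orderTopologicalType (d i)).
Hypothesis cX : forall i, compact [set: X i].
Hypothesis sX : forall i, separable (X i).

Let cP : compact [set: prod_topology X].
Proof. exact: compact_prod_topology. Qed.

Lemma dissipated_prod : dissipated R `I_(2 ^ n + 1) (prod_topology X).
Proof.
split=> // Z g cZ mZ cg.
have [E cE gE] := countable_cuts cX mZ cg.
have [D HD] : {D : forall i, set (X i) |
    forall i, countable (D i) /\ dense (D i)}.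
  by apply: (all_sig (P := fun i D => countable D /\ dense D)) => i; apply: cid;
    have [D] := sX i; exists D.
(* Isolating the points of [E i] makes [f] finer than [g]; isolating those of the dense set [D i]
   bounds the fibers by two points. *)
have cED i : countable (E i `|` D i).
  by apply: countable_setU => //; exact: (HD i).1.
have [h Hh] := all_sig (fun i =>
  cid (monotone_separating R (@cX i) (sX i) (cED i))).
pose c (j : 'I_n.+1 * nat) (x : prod_topology X) : R := h j.1 j.2 (x j.1).
have cc j : continuous (c j).
  case: (Hh j.1) => /(_ j.2) ch _ _ _ x.
  apply: (@continuous_comp (prod_topology X) (X j.1) R (proj j.1) (h j.1 j.2)).
    exact: proj_continuous.
  exact: ch.
have c01 j x : (0 <= c j x <= 1)%R by case: (Hh j.1) => _ _ H _; exact: H.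
have [Y [f [cY mY cf fE]]] := compact_metrizable_quotient cP cc c01.
have {}fE x y : f x = f y <-> forall i, (h i)^~ (x i) = (h i)^~ (y i).
  split=> [/fE cxy i|hxy]; first by apply/funext => k; exact: (cxy (i, k)).
  by apply/fE => -[i k]; exact: (congr1 (@^~ k) (hxy i)).
exists Y, f; split => //.
  apply: (tight_two_point_fibers (p := fun i (x : X i) => (h i)^~ x)) => //.
  - exact: metrizable_hausdorff mY.
  - move=> i x y z xy yz; case: (Hh i) => _ hm _ _.
    exact: monotone_fiber_convex.
  - move=> i x y z; case: (Hh i) => _ hm _ hE.
    apply: (@monotone_fiber_le2 R _ _ (E i `|` D i)) => //.
    by move=> O /(HD i).2 H /H [z' [Oz Dz]]; exists z'; split => //; right.
apply: compact_finer => //; first exact: metrizable_hausdorff mY.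
(* A cut [s] in [E i] between [x i] and [y i] would lie in their common fiber by convexity, hence
   equal [x i] as it is isolated by [h i]. *)
move=> x y /fE hxy; apply: gE => i s Es; case: (Hh i) => _ hm _ hE.
split=> [sx|xs]; rewrite ltNge; apply/negP => H.
  have hs := monotone_fiber_convex hm H (ltW sx) (esym (hxy i)).
  have xE := hE s (x i) (or_introl Es); rewrite xE ?ltxx// in sx.
  by rewrite hs hxy.
have hs := monotone_fiber_convex hm (ltW xs) H (hxy i).
by have xE := hE s (x i) (or_introl Es); rewrite xE ?ltxx// in xs.
Qed.

Lemma not_dissipated_prod : (forall i, ~ scattered (X i)) ->
  (forall i j, @second_countable (X i) -> @second_countable (X j) -> i = j) ->
  ~ dissipated R `I_(2 ^ n) (prod_topology X).
Proof.
move=> nsX scX [_ dX].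
(* [m] is the second countable coordinate if there is one, and 0 otherwise. *)
have [m Hm] : exists m, forall k, ~ @second_countable (X (lift m k)).
  have [[m scm]|nsc] := pselect (exists i, @second_countable (X i)).
    exists m => k sck; have := scX _ _ scm sck.
    by move/eqP; rewrite (negbTE (neq_lift _ _)).
  by exists ord0 => k sck; apply: nsc; exists (lift ord0 k).
have [D cD dD] := sX m.
have [h [ch hm h01 hD]] := monotone_separating R (@cX m) (sX m) cD.
have [Z [q [cZ mZ cq qE]]] := compact_metrizable_quotient (@cX m) ch h01.
(* Any [f] finer than this [g] has fibers of at most two points on each copy of [X m]. *)
pose g : prod_topology X -> Z := q \o proj m.
have cg : continuous g.
  by move=> x; apply: continuous_comp; [exact: proj_continuous|exact: cq].
have [Y [f [cY mY cf tf [Gam _ fg]]]] := dX Z g cZ mZ cg.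
have {}fg x y : f x = f y -> g x = g y.
  move=> fxy; rewrite !fg; congr (set_val (Gam _)); exact: val_inj.
have [E cE fE] := countable_cuts cX mY cf.
have x_ex i : exists x : X i, True.
  by have /existsNP [A /contrapT [_ [x _] _]] := nsX i; exists x.
have uv_ex i : exists uv : X i * X i, i <> m ->
    [/\ uv.1 <> uv.2, same_side (E i) uv.1 uv.2 & same_side (E i) uv.2 uv.1].
  have [x _] := x_ex i.
  case: (unliftP m i) => [k ->|im]; last by exists (x, x) => /(_ im).
  (* No point lies strictly between the ends of a jump, and these ends avoid [E], so no cut of [E]
     tells them apart. *)
  have [u [v [[uv juv] nEu nEv]]] := exists_jump (sX (lift m k)) (Hm k) (cE _).
  exists (u, v) => _; split=> /= [vu|s Es|s Es].
  - by rewrite vu ltxx in uv.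
  - split=> [su|us]; first exact: lt_trans uv.
    rewrite ltNge; apply/negP; rewrite le_eqVlt => /orP[/eqP sv|sv].
      by apply: nEv; rewrite -sv.
    by apply: (juv s); rewrite us.
  - split=> [sv|vs]; last exact: lt_trans vs.
    rewrite ltNge; apply/negP; rewrite le_eqVlt => /orP[/eqP us|us].
      by apply: nEu; rewrite us.
    by apply: (juv s); rewrite us.
have [uv Huv] := all_sig (fun i => cid (uv_ex i)).
pose pick (e : bool) i := if e then (uv i).1 else (uv i).2.
have pick_inj k e e' : pick e (lift m k) = pick e' (lift m k) -> e = e'.
  have [|uvk _ _] := Huv (lift m k).
    by move/esym/eqP; rewrite (negbTE (neq_lift _ _)).
  by case: e; case: e' => //= /esym.
have pick_side k e e' :
    same_side (E (lift m k)) (pick e (lift m k)) (pick e' (lift m k)).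
  have [|_ uvk vuk] := Huv (lift m k).
    by move/esym/eqP; rewrite (negbTE (neq_lift _ _)).
  by case: e; case: e'.
pose slice (e : {ffun 'I_n -> bool}) :=
  [set x : prod_topology X | forall k, x (lift m k) = pick (e k) (lift m k)].
(* The default [(uv i).1] occurs only at [i = m], where [dfwith] replaces it by [z]. *)
pose iota (e : {ffun 'I_n -> bool}) (z : X m) : prod_topology X :=
  dfwith (fun i => if unlift m i is Some k then pick (e k) i else (uv i).1) m z.
have iotam e z : iota e z m = z by rewrite /iota dfwithin.
have iota_slice e z : slice e (iota e z).
  by move=> k; rewrite /iota dfwithout ?neq_lift// liftK.
have slice_inj : injective slice.
  move=> e e' ee'; apply/ffunP => k; apply: (pick_inj k).
  have [z _] := x_ex m.
  have := iota_slice e z k; have : slice e' (iota e z) by rewrite -ee'.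
  by move=> /(_ k) -> ->.
have slice_cut e x e' y : slice e x -> slice e' y -> x m = y m -> f x = f y.
  move=> ex ey xym; apply: fE => i; case: (unliftP m i) => [k ->|->].
    by rewrite ex ey; exact: pick_side.
  by rewrite xym.
pose e0 : {ffun 'I_n -> bool} := [ffun=> true].
have slice_im e : f @` slice e = f @` slice e0.
  apply/seteqP; split=> _ [x sx <-].
    by exists (iota e0 (x m)) => //; apply: slice_cut sx _; rewrite ?iotam.
  by exists (iota e (x m)) => //; apply: slice_cut sx _; rewrite ?iotam.
apply: tf; exists (range slice); last first.
  have := inj_card_eq (A := [set: {ffun 'I_n -> bool}]) (in2W slice_inj).
  move=> /card_eq_trans; apply.
  have := card_eq_finType {ffun 'I_n -> bool}.
  by rewrite card_ffun card_bool card_ord.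
split.
- move=> _ _ [e _ <-] [e' _ <-] [x [ex e'x]]; congr slice.
  by apply/ffunP => k; apply: (pick_inj k); rewrite -ex -e'x.
- move=> _ [e _ <-].
  have -> : slice e = \bigcap_(k in [set: 'I_n])
      (proj (lift m k) @^-1` [set pick (e k) (lift m k)]).
    by apply/seteqP; split=> x ex k; [move=> _|]; exact: ex.
  apply: closed_bigI => k _; apply: preimage_closed.
    by move=> x _; exact: proj_continuous.
  apply: accessible_closed_set1; exact/hausdorff_accessible/order_hausdorff.
exists (f @` slice e0); last by move=> _ [e _ <-].
(* The common image of the slices is not scattered because it contains the image under [k] of a
   perfect set [A], which stays perfect as [k] is at most two-to-one. *)
have /existsNP [A /contrapT [clA [a Aa] iA]] := nsX m.
pose k z := f (iota e0 z).
have ck : continuous k.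
  move=> z; apply: (@continuous_comp (X m) (prod_topology X) Y (iota e0) f).
    exact: dfwith_continuous.
  exact: cf.
have kh z z' : k z = k z' -> h^~ z = h^~ z'.
  move=> /fg; rewrite /g /= /proj !iotam => /qE H.
  by apply/funext => j; exact: H.
apply: (@perfect_not_scattered _ _ (k @` A)); last first.
  by move=> _ [z _ <-]; exists (iota e0 z).
split.
- apply: compact_closed; first exact: metrizable_hausdorff mY.
  apply: continuous_compact; first exact: continuous_subspaceT.
  exact: subclosed_compact clA (@cX m) _.
- by exists (k a), a.
- apply: isolated_image => //; first exact/hausdorff_accessible/order_hausdorff.
  move=> x y z /kh hxy /kh hyz.
  (* Three distinct points of one fiber, in whatever order, would contradict [no3]. *)
  have no3 := monotone_fiber_le2 hm dD hD.
  have [xy|yx|->] := ltgtP x y; last by constructor 1.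
    have [yz|zy|->] := ltgtP y z; last by constructor 2.
      by case: (no3 _ _ _ xy yz); rewrite hxy.
    have [xz|zx|->] := ltgtP x z; last by constructor 3.
      by case: (no3 _ _ _ xz zy).
    by case: (no3 _ _ _ zx xy).
  have [yz|zy|->] := ltgtP y z; last by constructor 2.
    have [xz|zx|->] := ltgtP x z; last by constructor 3.
      by case: (no3 _ _ _ yx xz).
    by case: (no3 _ _ _ yz zx).
  by case: (no3 _ _ _ zy yx); rewrite hxy.
Qed.

End dissipated_product.

Theorem theorem3p9 (R : realType) (n : nat) (d : 'I_n.+1 -> Order.disp_t)
    (X : forall i : 'I_n.+1, orderTopologicalType (d i))
    (cX : forall i, compact [set: X i])
    (sX : forall i, separable (X i)) :
  dissipated R `I_(2 ^ n + 1) (prod_topology X) /\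
  ((forall i, ~ scattered (X i)) ->
   (forall i j, @second_countable (X i) -> @second_countable (X j) -> i = j) ->
   ~ dissipated R `I_(2 ^ n) (prod_topology X)).
Proof. by split; [exact: dissipated_prod|exact: not_dissipated_prod]. Qed.
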